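(* Let $(X,d)$ be a cone metric space and let $r\in E$ with $0\ll r$ or $r=0$. Let $\{x_n\}$ be a sequence in $X$ and let $\{y_n\}$ be a convergent sequence of points of $LIM^{r}x_n$ converging to $y_0\in X$. Then $y_0\in LIM^{r}x_n$.
   Context: Let $E$ be a real Banach space. A subset $P\subset E$ is a cone if (i) $P$ is closed, nonempty and $P\neq\{0\}$; (ii) $a,b\in\mathbb{R}$, $a,b\ge 0$, $x,y\in P$ implies $ax+by\in P$; (iii) $x\in P$ and $-x\in P$ implies $x=0$. Write $x\le y$ if $y-x\in P$, $x<y$ if $x\le y$ and $x\ne y$, and $x\ll y$ if $y-x\in \mathrm{int}\,P$ (the interior of $P$). A cone metric space $(X,d)$ (associated with $E$ and $P$) is a nonempty set $X$ with a map $d:X\times X\to E$ such that for all $x,y,z\in X$: $0\le d(x,y)$, and $d(x,y)=0$ iff $x=y$; $d(x,y)=d(y,x)$; $d(x,y)\le d(x,z)+d(z,y)$. A sequence $\{y_n\}$ in $X$ converges to $y\in X$ if for every $c\in E$ with $0\ll c$ there is $k\in\mathbb{N}$ such that $d(y_n,y)\ll c$ for all $n>k$. For $r\in E$ with $0\ll r$ or $r=0$, a sequence $\{x_n\}$ in $X$ is $r$-convergent to $x\in X$ if for every $\epsilon\in E$ with $0\ll\epsilon$ there is $k\in\mathbb{N}$ such that $d(x_n,x)\ll r+\epsilon$ for all $n\ge k$. The $r$-limit set is $LIM^{r}x_n=\{x\in X: \{x_n\}\text{ is } r\text{-convergent to } x\}$. *)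

(* Defs.v *)
From HB Require Import structures.
From mathcomp Require Import all_boot all_order all_algebra.
From mathcomp Require Import all_classical all_reals all_analysis.

Set Implicit Arguments.
Unset Strict Implicit.
Unset Printing Implicit Defensive.

Import Order.TTheory GRing.Theory Num.Theory.
Import numFieldNormedType.Exports.

Local Open Scope classical_set_scope.
Local Open Scope ring_scope.

Record is_cone (R : realType) (E : completeNormedModType R) (P : set E) : Prop :=
  IsCone {
    cone_closed : closed P ;
    cone_nonempty : P !=set0 ;
    cone_nontrivial : P <> [set 0] ;
    cone_comb : forall (a b : R) (x y : E),
      0 <= a -> 0 <= b -> P x -> P y -> P (a *: x + b *: y) ;
    cone_pointed : forall x : E, P x -> P (- x) -> x = 0
  }.

Definition cone_le (R : realType) (E : completeNormedModType R) (P : set E)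
  (x y : E) : Prop := P (y - x).

(* If [interior P] is empty then [cone_ll P] is the empty relation; cones with
   empty interior are not excluded. *)
Definition cone_ll (R : realType) (E : completeNormedModType R) (P : set E)
  (x y : E) : Prop := interior P (y - x).

Record is_cone_metric (R : realType) (E : completeNormedModType R) (P : set E)
    (X : Type) (d : X -> X -> E) : Prop :=
  IsConeMetric {
    cone_metric_inhabited : inhabited X ;
    cone_metric_ge0 : forall x y : X, cone_le P 0 (d x y) ;
    cone_metric_eq0 : forall x y : X, d x y = 0 <-> x = y ;
    cone_metric_sym : forall x y : X, d x y = d y x ;
    cone_metric_triangle : forall x y z : X,
      cone_le P (d x y) (d x z + d z y)
  }.

Definition cone_cvg (R : realType) (E : completeNormedModType R) (P : set E)
    (X : Type) (d : X -> X -> E) (u : nat -> X) (l : X) : Prop :=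
  forall c : E, cone_ll P 0 c ->
    exists k : nat, forall n : nat, (k < n)%N -> cone_ll P (d (u n) l) c.

Definition rough_cvg (R : realType) (E : completeNormedModType R) (P : set E)
    (X : Type) (d : X -> X -> E) (r : E) (u : nat -> X) (l : X) : Prop :=
  forall e : E, cone_ll P 0 e ->
    exists k : nat, forall n : nat, (k <= n)%N -> cone_ll P (d (u n) l) (r + e).

Definition rough_LIM (R : realType) (E : completeNormedModType R) (P : set E)
    (X : Type) (d : X -> X -> E) (r : E) (u : nat -> X) : set X :=
  [set l | rough_cvg P d r u l].

(* Main.v *)
Require Import Defs.
From mathcomp Require Import all_boot all_order all_algebra.
From mathcomp Require Import all_classical all_reals all_analysis.

Import Order.TTheory GRing.Theory Num.Theory.
Import numFieldNormedType.Exports.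

Local Open Scope classical_set_scope.
Local Open Scope ring_scope.

(** Split [e] into halves. One fixed term of [y] lies within [e/2] of [y0], and eventually [x n]
    lies within [r + e/2] of that term, so the triangle inequality puts [x n] within [r + e] of
    [y0]. Strictness survives because adding an element of [P] to an interior point stays interior
    ([interior_cone_add]); [interior_cone_scale] makes [e/2] an admissible tolerance. *)

(** Translating by [v] carries a ball around [u] inside [P] to one around [u + v], still inside
    [P]. *)
Lemma interior_cone_add (R : realType) (E : completeNormedModType R) (P : set E)
  (u v : E) : is_cone P -> interior P u -> P v -> interior P (u + v).
Proof.
move=> hP /nbhs_normP[e /= e0 he] Pv; apply/nbhs_normP; exists e => //= z /= hz.
have Pz : P (z - v).
  by apply: he => /=; rewrite opprB addrA.
by have := cone_comb hP ler01 ler01 Pz Pv; rewrite !scale1r subrK.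
Qed.

(** The homothety of ratio [a] preserves [P] and turns a ball of radius [e] into one of radius
    [a * e]. *)
Lemma interior_cone_scale (R : realType) (E : completeNormedModType R)
  (P : set E) (a : R) (u : E) :
  is_cone P -> 0 < a -> interior P u -> interior P (a *: u).
Proof.
move=> hP a0 /nbhs_normP[e /= e0 he]; have an0 : a != 0 by rewrite gt_eqF.
apply/nbhs_normP; exists (a * e); first by rewrite /= mulr_gt0.
move=> z /= hz.
have Pz : P (a^-1 *: z).
  apply: he => /=; rewrite -(ltr_pM2l a0); apply: le_lt_trans hz.
  by rewrite -{1}(gtr0_norm a0) -normrZ scalerBr scalerA divff // scale1r.
have := cone_comb hP (ltW a0) (lexx 0) Pz Pz.
by rewrite scale0r addr0 scalerA divff // scale1r.
Qed.

Theorem theorem3p7 (R : realType) (E : completeNormedModType R) (P : set E)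
  (hP : is_cone P)
  (X : Type) (d : X -> X -> E) (hd : is_cone_metric P d)
  (r : E) (hr : cone_ll P 0 r \/ r = 0)
  (x y : nat -> X) (y0 : X)
  (hy : forall n : nat, rough_LIM P d r x (y n))
  (hcv : cone_cvg P d y y0) :
  rough_LIM P d r x y0.
Proof.
move=> e; rewrite /cone_ll subr0 => he.
have he2 : cone_ll P 0 (2^-1 *: e).
  by rewrite /cone_ll subr0; apply: interior_cone_scale; rewrite ?invr_gt0.
(* The index is [m.+1] because [cone_cvg] bounds only the terms strictly after [m]; it is fixed
   before [k] is chosen. *)
have [m hm] := hcv _ he2; have [k hk] := hy m.+1 _ he2.
exists k => n /hk hn.
have hm1 : P (2^-1 *: e - d (y m.+1) y0) by apply: interior_subset (hm _ _).
have ht := cone_metric_triangle hd (x n) y0 (y m.+1).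
have := interior_cone_add _ _ _ _ _ hP
  (interior_cone_add _ _ _ _ _ hP hn hm1) ht.
(* The three summands telescope: both distances through [y m.+1] cancel, leaving
   [r + e - d (x n) y0]. *)
rewrite /cone_ll; congr (interior P _).
have -> : r + e = r + 2^-1 *: e + 2^-1 *: e.
  by rewrite -addrA -scalerDl -[2^-1]div1r -splitr scale1r.
by rewrite [X in X + _ = _]addrACA -opprD addrA subrK.
Qed.
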